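(* Let $k\geq 1$ be an integer. Suppose that the edges of the complete graph $K_n$ are coloured with two colours, red and blue. Then the vertices of $K_n$ can be covered by $k$ disjoint red paths and a blue balanced complete $(k+1)$-partite graph that is disjoint from all of these paths.
   Context: All subgraphs in a cover are pairwise vertex-disjoint, and together their vertex sets are all of $V(K_n)$. Paths are allowed to be empty (no vertices) or to consist of a single vertex; a red path is a path subgraph all of whose edges are red. A balanced complete $r$-partite graph has its vertex set partitioned into $r$ sets $A_1,\dots,A_r$ with $|A_1|=\dots=|A_r|=m$ for some integer $m\ge 0$ ($m=0$, the empty graph, is allowed), with an edge between two vertices if and only if they lie in different sets $A_i$, $A_j$. A blue balanced complete $r$-partite graph in a coloured $K_n$ is a (not necessarily induced) subgraph of this form all of whose edges are blue; there is no restriction on the colours of edges of $K_n$ inside a part. *)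

(* Defs.v *)
From mathcomp Require Import all_boot.
Set Implicit Arguments.
Unset Strict Implicit.
Unset Printing Implicit Defensive.

Inductive colour := Red | Blue.

(* The vertices of K_n are 'I_n and its edges are the pairs of distinct
   vertices. The values c x x are junk: they are never consulted below,
   since consecutive vertices of a path, and vertices in different parts,
   are distinct. *)
Definition edge_colouring (n : nat) (c : 'I_n -> 'I_n -> colour) : Prop :=
  forall x y : 'I_n, c x y = c y x.

Definition is_red (n : nat) (c : 'I_n -> 'I_n -> colour) : rel 'I_n :=
  fun x y => if c x y is Red then true else false.

(* A path subgraph is given by its sequence of vertices in order along the
   path; [::] is the empty path and [:: x] the path on the single vertex x. *)
Definition red_path (n : nat) (c : 'I_n -> 'I_n -> colour) (p : seq 'I_n) : Prop :=
  uniq p /\ sorted (is_red c) p.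

Definition blue_balanced_multipartite (n r : nat) (c : 'I_n -> 'I_n -> colour)
    (A : 'I_r -> {set 'I_n}) : Prop :=
  [/\ exists m : nat, forall i : 'I_r, #|A i| = m,
      forall i j : 'I_r, i != j -> [disjoint A i & A j]
    & forall i j : 'I_r, i != j ->
        forall x y : 'I_n, x \in A i -> y \in A j -> c x y = Blue].

(* Main.v *)
Require Import Defs.
From mathcomp Require Import all_boot.

(** Run depth-first search on the red graph, one vertex entering or leaving the
    stack at each step.  Write V_t for the vertices visited by time t and D_t for
    those already popped; the stack at time t is a red path with vertex set
    V_t \ D_t, and there are no red edges between D_t and the complement of V_t,
    since a vertex is popped only when it has no unvisited red neighbour
    ([dfs_inv]).

    Cut the time interval at 0 = t_0 <= t_1 <= ... <= t_(k+1), where everything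
    is popped by time t_(k+1).  The layers V_(t_(i+1)) \ V_(t_i) partition the
    vertices, and each layer splits in two.
    - The vertices popped by time t_(i+1) form A_i = D_(t_(i+1)) \ V_(t_i).  For
      i < j we have A_i inside D_(t_j) and A_j outside V_(t_j), so all edges
      between A_i and A_j are blue.
    - The remaining ones are on the stack at time t_(i+1) and were pushed after
      t_i.  They are the top part of the stack, hence form a red path
      ([dfs_new_path]).  The last layer has none, which leaves k paths.

    It remains to choose the cuts so that all A_i have the same size.  The size
    f(s,t) of D_t \ V_s increases with t and decreases with s, and each step of
    the search adds a vertex to D or to V, not to both.
    This makes a discrete intermediate value argument exact: for an equal
    splitting of [0,t) into j pieces, the common size m(t) is unique, it is
    constant over a push and grows by at most 1 over a pop, whereas f(t,u) drops
    by at most 1 over a push and is constant over a pop.  As t runs from 0 to u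
    the difference f(t,u) - m(t) therefore reaches 0, which yields an equal
    splitting of [0,u) into j+1 pieces ([splits_ex]). *)

Set Implicit Arguments.
Unset Strict Implicit.
Unset Printing Implicit Defensive.

(** * Cutting an interval into pieces of equal size *)

Section EqualPieces.

Variable f : nat -> nat -> nat.
Hypothesis f_diag : forall t, f t t = 0.
Hypothesis f_le_r : forall s t t', t <= t' -> f s t <= f s t'.
Hypothesis f_le_l : forall s s' t, s <= s' -> f s' t <= f s t.
(** The first alternative is a push at time [t], the second a pop; that at most
    one of the two arguments matters at each step is what lets the sweep in
    [splits_ex] hit equality instead of jumping over it. *)
Hypothesis f_step : forall t,
  ((forall s, f s t.+1 = f s t) /\ (forall u, f t u <= (f t.+1 u).+1)) \/
  ((forall s, f s t.+1 <= (f s t).+1) /\ (forall u, f t.+1 u = f t u)).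

(** The recursion removes the last piece, because the existence proof inducts on
    the number of pieces by sweeping the last inner cut. *)
Fixpoint splits (j m t : nat) : Prop :=
  if j is j'.+1 then exists s, [/\ s <= t, splits j' m s & f s t = m]
  else f 0 t = m.

(** Larger pieces push every cut to the right: if a cut has moved right and the
    piece following it is larger, then the next cut has moved right as well.
    Contrapositively, the common size is unique and nondecreasing in [t]. *)
Lemma splits_lt j m m' t t' :
  splits j m t -> splits j m' t' -> m < m' -> t < t'.
Proof.
elim: j t t' => [|j IHj] t t' /=.
  move=> <- <-; apply: contraTT; rewrite -!leqNgt; exact: f_le_r.
move=> [s [_ Hs Em]] [s' [_ Hs' Em']] lt_m; rewrite ltnNge; apply/negP => le_t.
have lt_s := IHj _ _ Hs Hs' lt_m.
move: lt_m; rewrite ltnNge => /negP; apply; rewrite -Em -Em'.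
exact: leq_trans (f_le_l _ (ltnW lt_s)) (f_le_r _ le_t).
Qed.

(** If the common size grows at all, then the last inner cut has moved right, so
    the last piece gains nothing but what the step itself adds. *)
Lemma splits_next j m m' t :
    (forall s, f s t.+1 <= (f s t).+1) ->
  splits j m t -> splits j m' t.+1 -> m' <= m.+1.
Proof.
move=> close Hm Hm'; case: (leqP m' m) => [/leqW //|lt_m].
case: j Hm Hm' => [|j] /= => [<- <- //|[s [_ Hs Em]] [s' [_ Hs' Em']]].
have lt_s := splits_lt Hs Hs' lt_m.
rewrite -Em -Em'; exact: leq_trans (f_le_l _ (ltnW lt_s)) (close s).
Qed.

(** The last inner cut [t] sweeps from 0 to [u].  The common size of the pieces
    before it starts at 0, so not above the size [f t u] of the last piece, and
    cannot overtake it without meeting it, because each step changes only one of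
    the two, by at most 1. *)
Lemma splits_ex j u : exists m, splits j m u.
Proof.
elim: j u => [|j IHj] u; first by exists (f 0 u).
suff [t [le_tu Ht]] : exists t, t <= u /\ splits j (f t u) t.
  by exists (f t u), t.
have sweep t : t <= u -> (exists t', t' <= u /\ splits j (f t' u) t') \/
                 exists2 m, splits j m t & m < f t u.
  (* A non-strict inequality suffices at each step: equality ends the sweep. *)
  have settle x m : x <= u -> splits j m x -> m <= f x u ->
      (exists t', t' <= u /\ splits j (f t' u) t') \/
      exists2 m, splits j m x & m < f x u.
    move=> le_x Hm; rewrite leq_eqVlt => /predU1P[Em|]; last by right; exists m.
    by left; exists x; rewrite -Em.
  elim: t => [_|t IHt lt_tu].
    have [m Hm] := IHj 0; apply: (settle _ m) => //.
    suff -> : m = 0 by [].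
    case: (j) Hm => [|j'] /= => [<- //|[s [s0 _ <-]]].
    by move: s0; rewrite leqn0 => /eqP->.
  have [|[m Hm lt_m]] := IHt (ltnW lt_tu); first by left.
  case: (f_step t) => [[Dt Vt]|[Dt Vt]].
    (* Push: the old cuts still give pieces of size m before t.+1. *)
    apply: (settle _ m) => //; last exact: leq_trans lt_m (Vt u).
    case: (j) Hm => [|j'] /=; first by rewrite Dt.
    by case=> s [le_st Hs Es]; exists s; rewrite Dt (leqW le_st).
  (* Pop: the cuts may all have to move, but the size grows by at most 1. *)
  have [m' Hm'] := IHj t.+1; apply: (settle _ m') => //; rewrite Vt.
  exact: leq_trans (splits_next Dt Hm Hm') lt_m.
case: (sweep u (leqnn u)) => // -[m _]; by rewrite f_diag.
Qed.

Lemma equal_pieces k u : exists m (t : nat -> nat),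
  [/\ t 0 = 0, t k.+1 = u, {homo t : i j / i <= j}
    & forall i, i <= k -> f (t i) (t i.+1) = m].
Proof.
have [m Hm] := splits_ex k u; exists m.
suff [t [t0 tu tS tf]] : exists t : nat -> nat,
    [/\ t 0 = 0, t k.+1 = u, forall i, t i <= t i.+1
      & forall i, i <= k -> f (t i) (t i.+1) = m].
  by exists t; split=> //; apply: homo_leq => // ? ? ?; apply: leq_trans.
elim: k u Hm => [|k IHk] u /= => [Em|[s [le_su /IHk[t [t0 ts tS tf]] Em]]].
  exists (fun i => if i is 0 then 0 else u).
  by split=> // [[|i]|[|i]].
exists (fun i => if i <= k.+1 then t i else u); split=> //.
- by rewrite ltnn.
- move=> i; case: (ltngtP i k.+1) => [_|_|->] //=; by rewrite ts.
- move=> i; rewrite leq_eqVlt ltnS => /predU1P[->|le_ik].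
    by rewrite eqxx ltnn ts.
  by rewrite le_ik orbT tf.
Qed.

End EqualPieces.

(** * Depth-first search as a sequence of pushes and pops *)

Section DepthFirstSearch.

Variables (T : finType) (e : rel T).

Record state := State { stack : seq T; done : {set T} }.

Definition visited (S : state) : {set T} := [set x in stack S] :|: done S.

Definition dfs_step (S : state) : state :=
  if stack S is x :: p then
    if [pick y | e y x && (y \notin visited S)] is Some y
    then State (y :: stack S) (done S) else State p (x |: done S)
  else if [pick y | y \notin visited S] is Some y
    then State [:: y] (done S) else S.

Variant dfs_step_spec (S : state) : state -> Type :=
(* Sortedness of y followed by the old top, if any, covers the pushes on an empty
   and on a nonempty stack at once. *)
| DfsPush y of y \notin visited S & sorted e (y :: take 1 (stack S)) :
    dfs_step_spec S (State (y :: stack S) (done S))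
| DfsPop x p of stack S = x :: p
              & (forall y, y \notin visited S -> ~~ e y x) :
    dfs_step_spec S (State p (x |: done S))
| DfsIdle of stack S = [::] & visited S = setT : dfs_step_spec S S.

Lemma dfs_stepP S : dfs_step_spec S (dfs_step S).
Proof.
rewrite /dfs_step; case Ep: (stack S) => [|x p].
  case: pickP => [y Vy|full]; first by rewrite -Ep; apply: DfsPush; rewrite ?Ep.
  by apply: DfsIdle => //; apply/setP=> y; rewrite in_setT; exact: negbFE (full y).
case: pickP => [y /andP[exy Vy]|none].
  by rewrite -Ep; apply: DfsPush; rewrite ?Ep //= take0 exy.
apply: (DfsPop Ep) => y Vy; by have := none y; rewrite Vy andbT => ->.
Qed.

Definition dfs t := iter t dfs_step (State [::] set0).
Local Notation p := (fun t => stack (dfs t)).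
Local Notation D := (fun t => done (dfs t)).
Local Notation V := (fun t => visited (dfs t)).

Lemma visited_push S y : visited (State (y :: stack S) (done S)) = y |: visited S.
Proof. by apply/setP=> z; rewrite !inE orbA. Qed.

Lemma visited_pop S x q :
  stack S = x :: q -> visited (State q (x |: done S)) = visited S.
Proof. by move=> Ep; apply/setP=> z; rewrite !inE Ep inE orbCA orbA. Qed.

Lemma done_visited t : D t \subset V t.
Proof. exact: subsetUr. Qed.

Lemma dfs_change t :
  (exists2 y, V t.+1 = y |: V t & D t.+1 = D t) \/
  (exists2 x, V t.+1 = V t & D t.+1 = x |: D t) \/
  (V t.+1 = V t /\ D t.+1 = D t).
Proof.
rewrite /=; case: dfs_stepP => [y _ _|x q Ep _|_ _] /=.
- by left; exists y; rewrite ?visited_push.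
- by right; left; exists x; rewrite ?(visited_pop Ep).
- by right; right.
Qed.

Lemma visited_homo : {homo (fun t => V t) : s t / s <= t >-> s \subset t}.
Proof.
apply: homo_leq => [X|X Y Z|t]; [exact: subxx | exact: subset_trans |].
case: (dfs_change t) => [[y -> _]|[[x -> _]|[-> _]]] //; exact: subsetUr.
Qed.

Lemma done_homo : {homo (fun t => D t) : s t / s <= t >-> s \subset t}.
Proof.
apply: homo_leq => [X|X Y Z|t]; [exact: subxx | exact: subset_trans |].
case: (dfs_change t) => [[y _ ->]|[[x _ ->]|[_ ->]]] //; exact: subsetUr.
Qed.

(** The separation of D from the unvisited vertices survives a pop because the
    popped vertex has no unvisited neighbour, and a push because V only grows. *)
Lemma dfs_inv t :
  [/\ uniq (p t), [disjoint p t & D t], sorted e (p t)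
    & forall x y, x \in D t -> y \notin V t -> ~~ e y x].
Proof.
elim: t => [|t /= [Up dis_p sort_p sep]].
  by split=> // [|x y]; rewrite ?inE // disjoint_has.
case: dfs_stepP => [y Vy sort_y|x q Ep isol|_ _] /=; last by split.
- have [py Dy] : y \notin stack (dfs t) /\ y \notin done (dfs t).
    by apply/andP; rewrite -negb_or; move: Vy; rewrite !inE.
  split=> [||| x z Dx]; first by rewrite py.
  + by rewrite disjoint_cons Dy.
  + by move: sort_y sort_p; case: (stack _) => //= x q; rewrite take0 /= andbT => ->.
  + by rewrite visited_push !inE negb_or => /andP[_ Vz]; apply: sep Dx _; rewrite !inE.
- move: Up dis_p sort_p; rewrite Ep /= disjoint_cons.
  move=> /andP[xq Uq] /andP[xD dis_q] sort_q.
  split=> // [||z y]; last 1 first.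
  + rewrite (visited_pop Ep) => /setU1P[->|Dz] Vy; [exact: isol | exact: sep].
  + apply/pred0P=> z /=; rewrite !inE; apply/negP=> /andP[qz /predU1P[zx|Dz]].
      by rewrite -zx qz in xq.
    by rewrite (disjointFr dis_q qz) in Dz.
  + exact: path_sorted sort_q.
Qed.

(** Each vertex is pushed once and popped once, so every step adds one to
    [#|V| + #|D|] until both sets are full. *)
Lemma dfs_progress t : t <= 2 * #|T| -> t <= #|V t| + #|D t|.
Proof.
elim: t => // t IHt lt_t; have {IHt} := IHt (ltnW lt_t).
have [_ dis_p _ _] := dfs_inv t; move: dis_p => /=.
case: dfs_stepP => [y Vy _|x q Ep _|p0 VT] dis_p /=.
- by rewrite visited_push cardsU1 Vy.
- rewrite (visited_pop Ep) cardsU1; move: dis_p.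
  by rewrite Ep disjoint_cons => /andP[-> _]; rewrite addnCA.
- move=> _; suff E : done (dfs t) = setT by rewrite VT E cardsT addnn -mul2n.
  by rewrite -VT /visited p0; apply/setP=> z; rewrite !inE.
Qed.

Lemma dfs_done : D (2 * #|T|) = setT.
Proof.
have := dfs_progress (leqnn _); rewrite mul2n -addnn => le_sum.
apply/eqP; rewrite eqEcard subsetT cardsT /=.
by rewrite -(leq_add2l #|T|) (leq_trans le_sum) // leq_add2r max_card.
Qed.

(** The stack is last-in first-out, so the vertices pushed after time [s] lie
    above those that were on it already. *)
Lemma dfs_stack_split s t : s <= t ->
  exists q r, [/\ p t = q ++ r, {in q, forall x, x \notin V s} & {subset r <= V s}].
Proof.
move=> le_st; rewrite -(subnKC le_st); elim: (t - s) => [|d /= [q [r [Ep Vq Vr]]]].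
  by exists [::], (p s); rewrite addn0; split=> // x px; rewrite !inE px.
rewrite addnS /=; case: dfs_stepP => [y Vy _|x q' Ep' _|_ _] /=; last by exists q, r.
- exists (y :: q), r; split=> //=; first by rewrite Ep.
  move=> x; rewrite inE => /predU1P[->|]; last exact: Vq.
  by apply: contra Vy; apply: subsetP (visited_homo (leq_addr d s)) y.
- case: q Ep Vq => [|z q] /= Ep Vq; move: Ep'; rewrite Ep.
    case: r Vr {Ep} => //= z r Vr [_ <-]; exists [::], r; split=> // w rw.
    by apply: Vr; rewrite inE rw orbT.
  case=> _ <-; exists q, r; split=> // w qw; apply: Vq; by rewrite inE qw orbT.
Qed.

(** The vertices in question are a prefix of the stack, and therefore consecutive
    on the path that it forms. *)
Lemma dfs_new_path s t : s <= t ->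
  let q := [seq x <- p t | x \notin V s] in uniq q /\ sorted e q.
Proof.
move=> le_st q; have [Up _ sort_p _] := dfs_inv t; split; first exact: filter_uniq.
have [q' [r [Ep Vq Vr]]] := dfs_stack_split le_st.
suff -> : q = q' by move: sort_p => /=; rewrite Ep => /cat_sorted2[].
rewrite /q Ep filter_cat (eq_in_filter (a2 := predT)) => [|x /Vq ->] //.
rewrite filter_predT (eq_in_filter (a2 := pred0)) ?filter_pred0 ?cats0 // => x /Vr Vx.
by rewrite Vx.
Qed.

Lemma dfs_equal_pieces k : exists m (t : nat -> nat),
  [/\ t 0 = 0, t k.+1 = 2 * #|T|, {homo t : i j / i <= j}
    & forall i, i <= k -> #|D (t i.+1) :\: V (t i)| = m].
Proof.
apply: (@equal_pieces (fun s t => #|D t :\: V s|)).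
- move=> t; apply/eqP; rewrite cards_eq0 setD_eq0; exact: done_visited.
- by move=> s t t' le_t; apply/subset_leq_card/setSD/done_homo.
- by move=> s s' t le_s; apply/subset_leq_card/setDS/visited_homo.
- move=> t; case: (dfs_change t) => [[y -> ->]|[[x -> ->]|[-> ->]]].
  + left; split=> // u; rewrite setUC -setDDl.
    by rewrite (cardsD1 y (_ :\: V t)) -add1n leq_add2r leq_b1.
  + right; split=> // s; rewrite setDUl -add1n.
    apply: leq_trans (leq_card_setU _ _) _; rewrite leq_add2r.
    by rewrite -(cards1 x); apply/subset_leq_card/subsetDl.
  + by left; split.
Qed.

Lemma dfs_visited_done t u x y : t <= u ->
  x \in D t -> y \notin V u -> ~~ e y x.
Proof.
move=> le_tu Dx; have [_ _ _ sep] := dfs_inv u.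
exact: sep (subsetP (done_homo le_tu) _ Dx).
Qed.

End DepthFirstSearch.

(** * Red paths and blue parts in the layers between equal cuts *)

Theorem theorem1p7 (k n : nat) (hk : 1 <= k)
    (c : 'I_n -> 'I_n -> colour) (hc : edge_colouring c) :
  exists (P : 'I_k -> seq 'I_n) (A : 'I_k.+1 -> {set 'I_n}),
    (forall i : 'I_k, red_path c (P i)) /\
    blue_balanced_multipartite c A /\
    (forall i j : 'I_k, i != j -> [disjoint P i & P j]) /\
    (forall (i : 'I_k) (j : 'I_k.+1), [disjoint P i & A j]) /\
    (forall v : 'I_n,
       (exists i : 'I_k, v \in P i) \/ (exists j : 'I_k.+1, v \in A j)).
Proof.
set e := is_red c.
have [m [t [t0 tN t_homo t_card]]] := dfs_equal_pieces e k.
pose V i := visited (dfs e (t i)); pose D i := done (dfs e (t i)).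
pose P (i : 'I_k) := [seq x <- stack (dfs e (t i.+1)) | x \notin V i].
pose A (i : 'I_k.+1) := D i.+1 :\: V i.
have V_homo i j : i <= j -> V i \subset V j by move=> le_ij; apply/visited_homo/t_homo.
have P_new i x : x \in P i -> [&& x \notin V i, x \in V i.+1 & x \notin D i.+1].
  rewrite mem_filter => /andP[-> px]; have [_ dis_p _ _] := dfs_inv e (t i.+1).
  by rewrite !inE px (disjointFr dis_p px).
have A_new i x : x \in A i -> [&& x \notin V i, x \in V i.+1 & x \in D i.+1].
  rewrite !inE => /andP[-> Dx]; by rewrite Dx orbT.
(* The sets V i.+1 minus V i are pairwise disjoint, which settles all the
   disjointness claims except those inside a single layer. *)
have same_layer i j x : x \notin V i -> x \in V i.+1 ->
    x \notin V j -> x \in V j.+1 -> i = j.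
  have le i' j' : x \notin V i' -> x \in V j'.+1 -> i' <= j'.
    move=> Vi Vj; rewrite leqNgt; apply: contra Vi => lt_ji.
    exact: subsetP (V_homo _ _ lt_ji) x Vj.
  by move=> *; apply/eqP; rewrite eqn_leq !le.
exists P, A; split; first by move=> i; apply: dfs_new_path; apply: t_homo.
split.
  split.
  - by exists m => i; apply: t_card; rewrite -ltnS.
  - move=> i j neq_ij; apply/pred0P=> x /=; apply: contraNF neq_ij.
    case/andP=> /A_new/and3P[? ? _] /A_new/and3P[? ? _].
    by apply/eqP/val_inj/(same_layer _ _ x).
  - have blue_lt (i j : 'I_k.+1) x y : i < j -> x \in A i -> y \in A j -> c y x = Blue.
      move=> lt_ij /A_new/and3P[_ _ Dx] /A_new/and3P[Vy _ _].
      have := dfs_visited_done (t_homo _ _ lt_ij) Dx Vy.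
      by rewrite /e /is_red; case: (c y x).
    move=> i j neq_ij x y Ax Ay; have [lt_ij|lt_ji|/val_inj eq_ij] := ltngtP i j.
    + by rewrite hc; apply: blue_lt lt_ij Ax Ay.
    + exact: blue_lt lt_ji Ay Ax.
    + by rewrite eq_ij eqxx in neq_ij.
split.
  move=> i j neq_ij; apply/pred0P=> x /=; apply: contraNF neq_ij.
  case/andP=> /P_new/and3P[? ? _] /P_new/and3P[? ? _].
  by apply/eqP/val_inj/(same_layer _ _ x).
split.
  move=> i j; apply/pred0P=> x /=; apply/negP.
  case/andP=> /P_new/and3P[Vi Vi1 Di] /A_new/and3P[Vj Vj1 Dj].
  by move: Di; rewrite (same_layer _ _ _ Vi Vi1 Vj Vj1) Dj.
move=> v.
have D_last : v \in D k.+1 by rewrite /D tN dfs_done inE.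
have V_last : v \in V k.+1 := subsetP (done_visited e (t k.+1)) v D_last.
have reached : exists i, v \in V i.+1 by exists k.
(* The layer of v is given by the first cut at which v has been visited. *)
have [i Vi1 first_i] := ex_minnP reached.
have le_ik : i <= k := first_i k V_last.
have Vi : v \notin V i.
  case: i first_i {Vi1 le_ik} => [_|i first_i]; first by rewrite /V t0 !inE.
  by apply/negP=> /first_i; rewrite ltnn.
have [Di|Di] := boolP (v \in D i.+1).
  by right; exists (Ordinal (le_ik : i < k.+1)); rewrite inE Vi.
(* Everything is popped at the last cut, so v cannot be in the last layer. *)
left; have lt_ik : i < k.
  by rewrite ltn_neqAle le_ik andbT; apply: contraNneq Di => ->.
exists (Ordinal lt_ik); rewrite mem_filter Vi /=.
by move: Vi1; rewrite !inE (negPf Di) orbF.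
Qed.
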